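(* Let $f:Y\to X$ be a cover of strongly connected finite digraphs. Then $g_X^*(1)$ divides $g_Y^*(1)$ in $\mathbb{Z}$. If in addition $\delta(X)=\delta(Y)=0$, then $m(X)\mid m(Y)$. If moreover $r_X=r_Y$ (still with $\delta(X)=\delta(Y)=0$), then the group morphism $\mathrm{BF}(Y)_{\rm tors}\to\mathrm{BF}(X)_{\rm tors}$ induced by $f$ is surjective, and $\#\mathrm{BF}(X)_{\rm tors}\mid\#\mathrm{BF}(Y)_{\rm tors}$.
   Context: Digraph $X=(V_X,E_X)$ with incidence $e\mapsto(o(e),t(e))$; strongly connected means a directed path exists between any two distinct vertices. A morphism $f:Y\to X$ is a pair of maps on vertices and edges compatible with $o$ and $t$. It is a cover if $f$ is surjective on vertices and for every $w\in V_Y$ it restricts to bijections $\{\varepsilon:o(\varepsilon)=w\}\to\{e:o(e)=f(w)\}$ and $\{\varepsilon:t(\varepsilon)=w\}\to\{e:t(e)=f(w)\}$. For finite $X$: $\mathcal{A}_X(v)=\sum_{o(e)=v}t(e)$ on $\mathbb{Z}V_X$, $\mathrm{BF}(X)=\mathrm{coker}(\mathcal{I}-\mathcal{A}_X)$, $g_X(u)=\det(\mathcal{I}-\mathcal{A}_Xu)\in\mathbb{Z}[u]$, $r_X=\mathrm{ord}_{u=1}g_X$, $g_X^*(1)$ the coefficient of $(u-1)^{r_X}$ in the Taylor expansion at $1$, $\delta(X)=r_X-\mathrm{rank}_{\mathbb{Z}}\mathrm{BF}(X)$, and when $\delta(X)=0$, $m(X)$ is the nonzero integer with $g_X^*(1)=m(X)\#\mathrm{BF}(X)_{\rm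 tors}$. The map $f$ induces $\mathbb{Z}V_Y\to\mathbb{Z}V_X$ intertwining the adjacency operators, hence a surjection $\mathrm{BF}(Y)\to\mathrm{BF}(X)$. *)

(* Defs.v *)
From HB Require Import structures.
From mathcomp Require Import all_boot all_order all_algebra.
From Stdlib Require Import ClassicalEpsilon.
Set Implicit Arguments. Unset Strict Implicit. Unset Printing Implicit Defensive.
Import Order.TTheory GRing.Theory Num.Theory.
Local Open Scope ring_scope.

Record digraph := Digraph {
  vert : finType;
  edge : finType;
  org : edge -> vert;
  trm : edge -> vert }.

Definition adj (X : digraph) : rel (vert X) :=
  fun v w => [exists e : edge X, (org e == v) && (trm e == w)].
Arguments adj X : clear implicits.

Definition strongly_connected (X : digraph) : Prop :=
  forall v w : vert X, v != w -> connect (adj X) v w.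

Record dcover (Y X : digraph) := DCover {
  fV : vert Y -> vert X;
  fE : edge Y -> edge X;
  fE_org : forall e, org (fE e) = fV (org e);
  fE_trm : forall e, trm (fE e) = fV (trm e);
  fV_surj : forall v : vert X, exists w, fV w = v;
  out_bij : forall (w : vert Y) (e : edge X), org e = fV w ->
      exists! eps : edge Y, org eps = w /\ fE eps = e;
  in_bij : forall (w : vert Y) (e : edge X), trm e = fV w ->
      exists! eps : edge Y, trm eps = w /\ fE eps = e }.

Definition ZV (X : digraph) := {ffun vert X -> int}.

(* A_X(v) = sum_{o(e)=v} t(e), extended Z-linearly:
   (A z)(w) = sum_{e : t e = w} z (o e). *)
Definition adjop (X : digraph) (z : ZV X) : ZV X :=
  [ffun w => \sum_(e : edge X | trm e == w) z (org e)].

Definition IminusA (X : digraph) (z : ZV X) : ZV X := z - adjop z.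

Definition inImg (X : digraph) (x : ZV X) : Prop := exists z : ZV X, x = IminusA z.

(* congruence modulo the image: equality in BF(X) = coker(I - A_X) *)
Definition bfeq (X : digraph) (x y : ZV X) : Prop := inImg (x - y).

Definition bftors (X : digraph) (x : ZV X) : Prop :=
  exists n : nat, (0 < n)%N /\ inImg (x *+ n).

Definition tors_card_is (X : digraph) (n : nat) : Prop :=
  exists s : seq (ZV X),
    [/\ size s = n,
        forall x, x \in s -> bftors x,
        forall i j : nat, (i < n)%N -> (j < n)%N -> i <> j ->
          ~ bfeq (nth 0 s i) (nth 0 s j) &
        forall x, bftors x -> exists2 y, y \in s & bfeq x y].

Definition card_tors (X : digraph) : nat :=
  epsilon (inhabits 0%N) (tors_card_is X).

Definition bf_indep (X : digraph) (k : nat) : Prop :=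
  exists fam : 'I_k -> ZV X,
    forall c : 'I_k -> int, inImg (\sum_(i < k) fam i *~ c i) -> forall i, c i = 0.

Definition rank_is (X : digraph) (k : nat) : Prop :=
  bf_indep X k /\ forall k', bf_indep X k' -> (k' <= k)%N.

Definition bf_rank (X : digraph) : nat := epsilon (inhabits 0%N) (rank_is X).

(* matrix of A_X in the basis V_X (enumerated): column v is A_X(v) *)
Definition adjmx (X : digraph) : 'M[int]_#|vert X| :=
  \matrix_(i, j) (#|[set e : edge X | (org e == enum_val j) && (trm e == enum_val i)]|%:Z).

Definition gpoly (X : digraph) : {poly int} :=
  \det (1%:M - 'X *: map_mx polyC (adjmx X)).

(* r_X = ord_{u=1} g_X : multiplicity of 1 as a root of g_X (computed in Q[u],
   since mup is defined over fields; g_X has integer coefficients) *)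
Definition rord (X : digraph) : nat := mup 1 (map_poly intr (gpoly X) : {poly rat}).

Definition gstar (X : digraph) : int := (gpoly X \Po ('X + 1))`_(rord X).

(* m(X) = g_X^*(1) / #BF(X)_tors (meaningful when delta(X) = 0) *)
Definition mX (X : digraph) : int := (gstar X %/ (card_tors X)%:Z)%Z.

Definition push (Y X : digraph) (f : dcover Y X) (y : ZV Y) : ZV X :=
  [ffun v => \sum_(w : vert Y | fV f w == v) y w].

(* Main.v *)
(** Write M = I - A for the operator of a digraph, acting on row vectors, and let
P be the matrix of the push-forward, which is split surjective and satisfies
M_Y P = P M_X because [f] is bijective on outgoing edges.  If Q P = 1 and
B P = C A, then det A divides det B: the bordered matrix [1, P; Q, 0] is
unimodular, and [B, 0; 0, 1] [1, P; Q, 0] = [B, C; Q, 0] [1, 0; 0, A].  Applied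
to I - u A_Y and I - u A_X this gives g_X | g_Y, and leading coefficients at
u = 1 are multiplicative.

Let M = L diag(D, 0) R be a Smith form with D nonsingular, let r be its nullity,
and let W be the upper left block of R L.  Then g(u) is (1 - u)^r times a
polynomial with value det D det W at 1, BF has rank r and #BF_tors = |det D|.
So if delta = 0, then m = +- det W, whose absolute value is the index of
ker M + (saturation of im M) in Z^V; P respects both summands, and the divisibility
criterion applies again.  When r_X = r_Y the free quotients of BF are identified
by P, so that P splits on the saturated images, and the criterion applied to D_Y
and D_X gives the divisibility of the torsion orders. *)
Require Import Defs.
From HB Require Import structures.
From mathcomp Require Import all_boot all_order all_algebra.
From Stdlib Require Import ClassicalEpsilon.
Set Implicit Arguments. Unset Strict Implicit. Unset Printing Implicit Defensive.
Import Order.TTheory GRing.Theory Num.Theory.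
Local Open Scope ring_scope.

(** * Determinants, and orders of vanishing at 1 *)

Lemma det_dvd_split (R : comNzRingType) (m n : nat) (A : 'M[R]_m) (B : 'M[R]_n)
    (C P : 'M[R]_(n, m)) (Q : 'M[R]_(m, n)) :
  Q *m P = 1%:M -> B *m P = C *m A -> exists h, \det B = h * \det A.
Proof.
(* Right multiplication by [1, -P; 0, 1] turns [1, P; Q, 0] into [1, 0; Q, -1], of determinant
   (-1)^m; hence the sign in the witness. *)
move=> QP BP; exists ((-1) ^+ m * \det (block_mx B C Q 0)).
have: block_mx B 0 0 1%:M *m block_mx 1%:M P Q 0 *m block_mx 1%:M (- P) 0 1%:M
      = block_mx B C Q 0 *m block_mx 1%:M 0 0 A *m block_mx 1%:M (- P) 0 1%:M.
  congr (_ *m _); rewrite !mulmx_block.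
  by rewrite !(mul0mx, mulmx0, mulmx1, mul1mx, addr0, add0r) BP.
move/(congr1 determinant); rewrite -mulmxA mulmx_block.
rewrite !(mul0mx, mulmx0, mulmx1, mul1mx, addr0, mulmxN) addNr QP.
rewrite !det_mulmx !(det_ublock, det_lblock) !det1 !(mul1r, mulr1).
rewrite -scaleN1r detZ det1 mulr1 => /(congr1 ( *%R ((-1) ^+ m))).
by rewrite mulrCA -expr2 sqrr_sign mulr1 mulrA.
Qed.

(** The two sizes agree only propositionally, as do those of the matrices in a Smith form. *)
Lemma det_conj (R : comNzRingType) (m n : nat) (A : 'M[R]_n)
    (L : 'M[R]_(m, n)) (L' : 'M[R]_(n, m)) :
  m = n -> L *m L' = 1%:M -> \det (L *m A *m L') = \det A.
Proof.
move=> e; case: n / e A L L' => A L L' LL'.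
by rewrite -mulmxA det_mulmx det_mulmx mulrCA -det_mulmx LL' det1 mulr1.
Qed.

Lemma mulmx1C_eqdim (R : comNzRingType) (m n : nat)
    (A : 'M[R]_(m, n)) (B : 'M[R]_(n, m)) :
  m = n -> A *m B = 1%:M -> B *m A = 1%:M.
Proof. by move=> e; case: n / e A B => A B /mulmx1C. Qed.

Lemma mup1_XsubC_exp (q : {poly int}) (m : nat) :
  q.[1] != 0 ->
  mup 1 (map_poly intr (('X - 1%:P) ^+ m * q) : {poly rat}) = m.
Proof.
move=> q1; rewrite rmorphM rmorphXn rmorphB /= map_polyX map_polyC mupMl.
  by rewrite mup_XsubCX eqxx.
rewrite /root (_ : (1 : rat) = intr 1) // horner_map /=.
by rewrite intr_eq0.
Qed.

Lemma coef_Taylor1 (q : {poly int}) (m : nat) :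
  ((('X - 1%:P) ^+ m * q) \Po ('X + 1))`_m = q.[1].
Proof.
rewrite comp_polyM rmorphXn rmorphB /= comp_polyX comp_polyC addrK.
rewrite coefXnM ltnn subnn -horner_coef0 horner_comp.
by rewrite hornerD hornerX hornerC add0r.
Qed.

Lemma factor_order1 (p : {poly int}) : p != 0 ->
  exists m q, q.[1] != 0 /\ p = ('X - 1%:P) ^+ m * q.
Proof.
move=> p0; have [m [q]] := multiplicity_XsubC p 1.
by rewrite p0 /= => q1 ->; exists m, q; rewrite mulrC.
Qed.

(** * Smith forms of integer matrices *)

Definition smithmx k r (d : 'I_k -> int) : 'M[int]_(k + r) :=
  block_mx (diag_mx (\row_i d i)) 0 0 0.

(** The change of basis matrices are typed as rectangular, with two-sided
inverses, because [n] is not syntactically [srk + snul]. *)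
Record smith n (M : 'M[int]_n) : Type := Smith {
  srk : nat;
  snul : nat;
  sdim : n = (srk + snul)%N;
  sdiv : 'I_srk -> int;
  sdiv_neq0 : forall i, sdiv i != 0;
  sL : 'M[int]_(n, srk + snul);
  sLi : 'M[int]_(srk + snul, n);
  sR : 'M[int]_(srk + snul, n);
  sRi : 'M[int]_(n, srk + snul);
  sLK : sL *m sLi = 1%:M;
  sLiK : sLi *m sL = 1%:M;
  sRK : sR *m sRi = 1%:M;
  sRiK : sRi *m sR = 1%:M;
  smithE : M = sL *m smithmx snul sdiv *m sR }.

Lemma smith_form n (M : 'M[int]_n) : smith M.
Proof.
have [L uL [R uR [d sd defM]]] := int_Smith_normal_form M.
pose nz i := d`_i != 0.
(* In a divisibility chain a zero forces all later entries to vanish, and entries past the end of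
   [d] read as 0: the nonzero ones form an initial segment. *)
have nzP i j : (i <= j)%N -> nz j -> nz i.
  rewrite /nz => leij dj.
  have jd : (j < size d)%N.
    by rewrite ltnNge; apply: contra dj => /(nth_default 0) ->.
  have /sorted_leq_nth : transitive (dvdz : rel int).
    by move=> x y z; apply: dvdz_trans.
  move=> /(_ dvdzz 0 d sd i j (leq_ltn_trans leij jd) jd leij).
  by apply: contraTneq => ->; rewrite -[dvdz _ _]/(0 %| _)%Z dvd0z.
pose k := find (predC nz) (iota 0 n).
have kn : (k <= n)%N by rewrite -[X in (_ <= X)%N](size_iota 0 n) find_size.
have ltk i : (i < k)%N -> nz i.
  move=> ik; have := before_find 0%N ik; rewrite nth_iota ?(leq_trans ik) //.
  by rewrite add0n /= => /negbFE.
have gek i : (k <= i)%N -> (i < n)%N -> d`_i = 0.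
  move=> ki lin; apply/eqP; have: has (predC nz) (iota 0 n).
    by rewrite has_find size_iota -/k (leq_ltn_trans ki).
  move/(nth_find 0%N); rewrite -/k nth_iota ?(leq_ltn_trans ki) // add0n /=.
  by rewrite -[_ == _]negbK; apply: contra; apply: nzP.
(* Replacing n - k by a variable [r] allows [n] to be rewritten as k + r, as the blocks require. *)
have dimn := subnKC kn; move: (n - k)%N dimn => r.
move: k kn ltk gek => k _ ltk gek dimn.
case: n / dimn M L R uL uR defM gek => M L R uL uR defM gek.
apply: (@Smith _ M k r erefl (fun i => d`_i) (fun i => ltk i (ltn_ord i))
          L (invmx L) R (invmx R)); rewrite ?mulmxV ?mulVmx //.
rewrite defM; congr (_ *m _ *m _); apply/matrixP => i j; rewrite mxE.
rewrite -[i]splitK -[j]splitK; case: (split i) => i'; case: (split j) => j' /=.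
- by rewrite block_mxEul !mxE.
- rewrite block_mxEur mxE; case: eqP => //= e.
  by have := ltn_ord i'; rewrite e -ltn_subRL subnn.
- rewrite block_mxEdl mxE; case: eqP => //= e.
  by have := ltn_ord j'; rewrite -e -ltn_subRL subnn.
- rewrite block_mxEdr mxE gek ?mul0rn ?leq_addr ?ltn_add2l //.
Qed.

Arguments sdiv {n M} s.
Arguments sdiv_neq0 {n M} s.

(** Conjugation by L turns 1 - u(1 - M) into (1 - u) + u diag(D, 0) R L, whose last r rows are (0, 1
    - u). It is block triangular, with diagonal blocks (1 - u) + u D W and 1 - u. *)
Lemma det_pencil n (M : 'M[int]_n) (s : smith M) :
  exists h : {poly int},
    \det (1%:M - 'X *: map_mx polyC (1%:M - M)) = ('X - 1%:P) ^+ snul s * h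
    /\ h.[1] = (-1) ^+ snul s * \prod_i sdiv s i * \det (ulsubmx (sR s *m sL s)).
Proof.
case: s => k r e d d0 L Li R Ri LK LiK RK RiK defM /=.
set W := R *m L; set D := diag_mx (\row_i d i).
pose pC := map_mx (polyC : int -> {poly int}).
pose E := (1 - 'X)%:M + 'X *: pC _ _ (D *m ulsubmx W).
exists ((-1) ^+ r * \det E); split; last first.
  rewrite hornerM -mulrA; congr (_ * _).
    by rewrite -polyCN -polyC_exp hornerC.
  rewrite -[LHS]/(horner_eval 1 _) -det_map_mx /E.
  rewrite [X in \det X](_ : _ = D *m ulsubmx W).
    by rewrite det_mulmx det_diag; under eq_bigr do rewrite mxE.
  rewrite map_mxD map_scalar_mx map_mxZ /= /horner_eval !hornerE subrr.
  rewrite raddf0 add0r scale1r.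
  by apply/matrixP => i j; rewrite !mxE hornerC.
have -> : 1%:M - 'X *: pC _ _ (1%:M - M) =
    pC _ _ L *m ((1 - 'X)%:M + 'X *: pC _ _ (smithmx r d *m W)) *m pC _ _ Li.
  rewrite mulmxDr mulmxDl -scalemxAr -scalemxAl mul_mx_scalar -scalemxAl.
  rewrite /pC -!map_mxM LK map_mx1 !mulmxA -defM.
  have -> : M *m L *m Li = M by rewrite -mulmxA LK mulmx1.
  by rewrite map_mxB map_mx1 scalerBr scalerBl scale1r opprB addrA addrAC.
rewrite det_conj //; last by rewrite /pC -map_mxM LK map_mx1.
rewrite -[W]submxK /smithmx mulmx_block !mul0mx !addr0 /pC map_block_mx.
rewrite scale_block_mx -/(pC _ _ _) !map_mx0 !scaler0 scalar_mx_block add_block_mx.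
rewrite !add0r addr0 det_ublock det_scalar -/E mulrC mulrA.
by rewrite -exprMn mulrN1 opprB.
Qed.

(** * Lattice vectors as rows, and the push-forward matrix *)

(** Transposed since [adjmx] acts on column vectors. *)
Definition lapmx (X : digraph) : 'M[int]_#|vert X| := 1%:M - (adjmx X)^T.

Definition zrow (X : digraph) (z : ZV X) : 'rV[int]_#|vert X| :=
  \row_i z (enum_val i).

Definition rowz (X : digraph) (v : 'rV[int]_#|vert X|) : ZV X :=
  [ffun x => v 0 (enum_rank x)].

Lemma zrowK X : cancel (@zrow X) (@rowz X).
Proof. by move=> z; apply/ffunP => x; rewrite ffunE mxE enum_rankK. Qed.

Lemma rowzK X : cancel (@rowz X) (@zrow X).
Proof. by move=> v; apply/rowP => i; rewrite mxE ffunE enum_valK. Qed.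

Lemma zrow_is_zmod_morphism X : zmod_morphism (@zrow X).
Proof. by move=> x y; apply/rowP => i; rewrite !mxE !ffunE. Qed.

HB.instance Definition _ X :=
  GRing.isZmodMorphism.Build (ZV X) 'rV[int]_#|vert X| (@zrow X)
    (@zrow_is_zmod_morphism X).

Lemma sum_enum_val (R : nmodType) (T : finType) (F : T -> R) :
  \sum_(x : T) F x = \sum_(i < #|T|) F (enum_val i).
Proof. exact: (reindex _ (onW_bij _ (enum_val_bij T))). Qed.

Lemma zrow_IminusA X (z : ZV X) : zrow (IminusA z) = zrow z *m lapmx X.
Proof.
rewrite /IminusA raddfB mulmxBr mulmx1 /=; congr (_ - _).
apply/rowP => j; rewrite !mxE ffunE.
rewrite (partition_big (fun e => org e) predT) //= sum_enum_val.
apply: eq_bigr => i _; rewrite !mxE -natz -sum1_card natr_sum mulr_sumr.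
rewrite (eq_bigl (fun e => (trm e == enum_val j) && (org e == enum_val i))) //.
rewrite [RHS](eq_bigl (fun e => (trm e == enum_val j) && (org e == enum_val i))).
  by apply: eq_bigr => e /andP[_ /eqP ->]; rewrite mulr1.
by move=> e; rewrite inE andbC.
Qed.

Lemma inImg_lapmx X (x : ZV X) :
  inImg x <-> exists v, zrow x = v *m lapmx X.
Proof.
split=> [[z ->]|[v e]]; first by exists (zrow z); rewrite zrow_IminusA.
by exists (rowz v); apply: (can_inj (@zrowK X)); rewrite zrow_IminusA rowzK.
Qed.

Lemma gpolyE X : gpoly X = \det (1%:M - 'X *: map_mx polyC (1%:M - lapmx X)).
Proof.
rewrite subKr -det_tr; congr determinant.
by apply/matrixP => i j; rewrite !mxE eq_sym.
Qed.

Definition pushmx Y X (f : dcover Y X) : 'M[int]_(#|vert Y|, #|vert X|) :=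
  \matrix_(i, j) (fV f (enum_val i) == enum_val j)%:R.

Lemma zrow_push Y X (f : dcover Y X) y : zrow (push f y) = zrow y *m pushmx f.
Proof.
apply/rowP => j; rewrite !mxE ffunE big_mkcond sum_enum_val.
by apply: eq_bigr => i _; rewrite !mxE; case: eqP; rewrite ?mulr1 ?mulr0.
Qed.

(** A choice of one preimage for each vertex gives a section. *)
Lemma pushmx_split Y X (f : dcover Y X) :
  exists Q : 'M[int]_(#|vert X|, #|vert Y|), Q *m pushmx f = 1%:M.
Proof.
have [g gK] := fin_all_exists (fV_surj f).
exists (\matrix_(i, j) (g (enum_val i) == enum_val j)%:R).
apply/matrixP => i l; rewrite !mxE (bigD1 (enum_rank (g (enum_val i)))) //=.
rewrite big1 => [|j jg]; rewrite !mxE.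
  by rewrite enum_rankK eqxx mul1r addr0 gK (inj_eq enum_val_inj).
case: eqP => [eg|]; last by rewrite mul0r.
by rewrite eg enum_valK eqxx in jg.
Qed.

(** The entry at (w, v) of either side counts the edges of Y that leave w and end above v; [out_bij]
    matches them with the edges of X from f(w) to v. *)
Lemma pushmx_adjmx Y X (f : dcover Y X) :
  (adjmx Y)^T *m pushmx f = pushmx f *m (adjmx X)^T.
Proof.
apply/matrixP => i j; rewrite !mxE; set w := enum_val i; set v := enum_val j.
transitivity (#|[set e | (org e == w) && (fV f (trm e) == v)]|%:Z).
  symmetry; rewrite -natz -sum1_card natr_sum.
  rewrite (partition_big (fun e => trm e) predT) //=.
  rewrite sum_enum_val; apply: eq_bigr => l _; rewrite !mxE.
  rewrite -natz -sum1_card natr_sum mulr_suml big_mkcond [RHS]big_mkcond.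
  apply: eq_bigr => e _; rewrite !inE mul1r; case: eqP => //= _.
  by rewrite andbC; case: (trm e =P _) => //= ->; case: (fV f _ =P _).
rewrite (bigD1 (enum_rank (fV f w))) //= big1 ?addr0 => [|l /negbTE lw].
  rewrite !mxE enum_rankK eqxx mul1r; congr (_%:Z).
  rewrite -(card_in_imset (f := fE f)) => [|e1 e2]; last first.
    rewrite !inE => /andP[/eqP o1 _] /andP[/eqP o2 _] e12.
    have oe : org (fE f e1) = fV f w by rewrite fE_org o1.
    have [e [_ ue]] := out_bij oe.
    by rewrite -(ue e1) // -(ue e2).
  apply: eq_card => e; rewrite inE; apply/imsetP/andP => [[e1]|[/eqP oe /eqP te]].
    by rewrite inE => /andP[/eqP o1 /eqP t1] ->; rewrite fE_org fE_trm o1 t1.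
  have [e1 [[o1 fe1] _]] := out_bij oe; exists e1 => //.
  by rewrite inE o1 -fE_trm fe1 te !eqxx.
rewrite !mxE; case: eqP => [e|]; last by rewrite mul0r.
by rewrite /w e enum_valK eqxx in lw.
Qed.

Lemma pushmx_lapmx Y X (f : dcover Y X) :
  lapmx Y *m pushmx f = pushmx f *m lapmx X.
Proof. by rewrite mulmxBl mulmxBr mul1mx mulmx1 pushmx_adjmx. Qed.

(** * The group BF in Smith coordinates *)

(** Coordinates along the basis given by the rows of [sR s]: the first [srk s] of
these rows span the saturation of the image, so a vector is torsion in BF exactly
when [fcoord] vanishes.  Locked, as [mxE] would otherwise unfold them. *)
HB.lock Definition tcoord X (s : smith (lapmx X)) (x : ZV X) : 'rV[int]_(srk s) :=
  lsubmx (zrow x *m sRi s).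

HB.lock Definition fcoord X (s : smith (lapmx X)) (x : ZV X) : 'rV[int]_(snul s) :=
  rsubmx (zrow x *m sRi s).

Definition zvec X (s : smith (lapmx X)) a b : ZV X := rowz (row_mx a b *m sR s).

Arguments zvec {X} s a b.

Section SmithCoordinates.
Variables (X : digraph) (s : smith (lapmx X)).

Fact tcoord_is_zmod_morphism : zmod_morphism (tcoord s).
Proof. by move=> x y; rewrite tcoord.unlock raddfB mulmxBl raddfB. Qed.

HB.instance Definition _ :=
  GRing.isZmodMorphism.Build (ZV X) 'rV[int]_(srk s) (tcoord s)
    tcoord_is_zmod_morphism.

Fact fcoord_is_zmod_morphism : zmod_morphism (fcoord s).
Proof. by move=> x y; rewrite fcoord.unlock raddfB mulmxBl raddfB. Qed.

HB.instance Definition _ :=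
  GRing.isZmodMorphism.Build (ZV X) 'rV[int]_(snul s) (fcoord s)
    fcoord_is_zmod_morphism.

Lemma zrow_zvec a b : zrow (zvec s a b) = row_mx a b *m sR s.
Proof. by rewrite rowzK. Qed.

Lemma tcoord_zvec a b : tcoord s (zvec s a b) = a.
Proof. by rewrite tcoord.unlock zrow_zvec -mulmxA sRK mulmx1 row_mxKl. Qed.

Lemma fcoord_zvec a b : fcoord s (zvec s a b) = b.
Proof. by rewrite fcoord.unlock zrow_zvec -mulmxA sRK mulmx1 row_mxKr. Qed.

Lemma zvec_coord x : zvec s (tcoord s x) (fcoord s x) = x.
Proof.
apply: (can_inj (@zrowK X)); rewrite zrow_zvec tcoord.unlock fcoord.unlock.
by rewrite hsubmxK -mulmxA sRiK mulmx1.
Qed.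

(** L is invertible over the integers, so the image is the row span of diag(D, 0) R. *)
Lemma inImgP (x : ZV X) :
  inImg x <-> fcoord s x = 0 /\ forall i, (sdiv s i %| tcoord s x 0%R i)%Z.
Proof.
have mul_smith a b : row_mx a b *m smithmx (snul s) (sdiv s)
    = row_mx (a *m diag_mx (\row_i sdiv s i)) 0.
  by rewrite mul_row_block !mulmx0 !addr0.
have mul_lapmx v : v *m lapmx X
    = v *m sL s *m smithmx (snul s) (sdiv s) *m sR s.
  by rewrite {1}(smithE s) !mulmxA.
split=> [/inImg_lapmx[v ev]|[fx0 dx]].
  have {ev}: zrow x *m sRi s
      = row_mx (lsubmx (v *m sL s) *m diag_mx (\row_i sdiv s i)) 0.
    rewrite -(mul_smith _ _ (rsubmx (v *m sL s))) hsubmxK ev mul_lapmx.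
    by rewrite -mulmxA sRK mulmx1.
  rewrite tcoord.unlock fcoord.unlock => ->; rewrite row_mxKr row_mxKl; split=> // i.
  by rewrite mul_mx_diag !mxE dvdz_mull.
apply/inImg_lapmx; pose w := \row_i (tcoord s x 0%R i %/ sdiv s i)%Z.
exists (row_mx w 0 *m sLi s).
rewrite mul_lapmx -(mulmxA _ (sLi s)) sLiK mulmx1 mul_smith.
rewrite -[in LHS](zvec_coord x) zrow_zvec fx0. congr (row_mx _ _ *m _).
by apply/rowP => i; rewrite mul_mx_diag !mxE divzK ?dx.
Qed.

Lemma bfeqP (x y : ZV X) :
  bfeq x y <-> fcoord s x = fcoord s y /\
    forall i, (sdiv s i %| tcoord s x 0%R i - tcoord s y 0%R i)%Z.
Proof.
rewrite /bfeq inImgP !raddfB /=; split=> [[/subr0_eq -> dxy]|[-> dxy]]; split=> //.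
- by move=> i; have := dxy i; rewrite !mxE.
- by rewrite subrr.
- by move=> i; rewrite !mxE.
Qed.

Lemma bftorsP (x : ZV X) : bftors x <-> fcoord s x = 0.
Proof.
split=> [[n [n0 /inImgP[]]]|fx0].
  rewrite raddfMn => /rowP fxn _; apply/rowP => i; have := fxn i.
  rewrite mulmxnE !mxE => /eqP; rewrite mulrn_eq0 eqn0Ngt n0 /=.
  by move/eqP.
(* The product is a common multiple of the divisors, so it kills every class with zero free
   coordinates. *)
exists (absz (\prod_i sdiv s i)); split.
  by rewrite absz_gt0; apply/prodf_neq0 => i _; apply: sdiv_neq0.
apply/inImgP; rewrite !raddfMn /= fx0 mul0rn; split=> // i.
rewrite mulmxnE -mulr_natr natz dvdz_mull // dvdzE /= -dvdzE.
by rewrite (bigD1 i) //= dvdz_mulr.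
Qed.

Lemma tors_card_smith : tors_card_is X (absz (\prod_i sdiv s i)).
Proof.
(* The classes are listed by one residue modulo each divisor, with zero free coordinates. *)
pose T := {dffun forall i : 'I_(srk s), 'I_`|sdiv s i|}.
pose rep (t : T) : ZV X := zvec s (\row_i (t i : nat)%:Z) 0.
have sizeT : size (map rep (enum T)) = absz (\prod_i sdiv s i).
  rewrite size_map -cardE card_dep_ffun foldrE big_map big_enum /=.
  rewrite (big_morph absz abszM absz1).
  by apply: eq_bigr => i _; rewrite card_ord.
have rep_inj t1 t2 : bfeq (rep t1) (rep t2) -> t1 = t2.
  move=> /bfeqP[_ d12]; apply/ffunP => i; apply: val_inj => /=.
  have : ((t1 i)%:Z == (t2 i)%:Z %[mod (absz (sdiv s i))%:Z])%Z.
    rewrite eqz_mod_dvd dvdzE absz_nat -dvdzE.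
    by have := d12 i; rewrite !tcoord_zvec !mxE.
  by rewrite !modz_nat eqz_nat !modn_small // => /eqP.
exists (map rep (enum T)); split=> //.
- by move=> x /mapP[t _ ->]; apply/bftorsP; rewrite fcoord_zvec.
- move=> i j; rewrite -sizeT size_map => ilt jlt ij.
  have t0 : T by case: (enum T) ilt.
  rewrite (nth_map t0 0 rep ilt) (nth_map t0 0 rep jlt) => /rep_inj /eqP.
  by rewrite nth_uniq ?enum_uniq // => /eqP.
- move=> x /bftorsP fx0.
  have lt_mod i : (`|(tcoord s x 0%R i %% sdiv s i)%Z| < `|sdiv s i|)%N.
    rewrite -ltz_nat abszE ger0_norm ?modz_ge0 ?sdiv_neq0 //.
    by rewrite ltz_mod ?sdiv_neq0.
  pose t : T := [ffun i => Ordinal (lt_mod i)].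
  exists (rep t); first by rewrite map_f ?mem_enum.
  apply/bfeqP; rewrite fx0 fcoord_zvec tcoord_zvec; split=> // i.
  rewrite !mxE ffunE /= abszE ger0_norm ?modz_ge0 ?sdiv_neq0 //.
  by rewrite -eqz_mod_dvd modz_mod.
Qed.

Lemma rank_smith : rank_is X (snul s).
Proof.
have fcoord_sum m (fam : 'I_m -> ZV X) (c : 'I_m -> int) :
    fcoord s (\sum_(i < m) fam i *~ c i)
    = (\row_i c i) *m \matrix_i fcoord s (fam i).
  rewrite raddf_sum mulmx_sum_row; apply: eq_bigr => i _.
  by rewrite raddfMz rowK mxE -scaler_int intz.
split.
  exists (fun i => zvec s 0 (delta_mx 0 i)) => c /inImgP[+ _] i.
  rewrite fcoord_sum => /rowP/(_ i).
  rewrite [X in _ *m X](_ : _ = 1%:M) ?mulmx1 ?mxE //.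
  by apply/row_matrixP => j; rewrite rowK fcoord_zvec row1.
move=> m [fam indep]; rewrite leqNgt; apply/negP => ltm.
pose G := \matrix_i fcoord s (fam i).
have [L uL [R _ [d _ defG]]] := int_Smith_normal_form G.
(* Counting from 0, row [snul s] of the diagonal form of [G] is zero, since its columns stop before.
   So this row of the inverse of [L] is a nonzero relation between the free coordinates; a positive
   multiple of it is a relation in BF. *)
pose c := row (Ordinal ltm) (invmx L).
have cG : c *m G = 0.
  rewrite /c -row_mul defG !mulmxA mulVmx // mul1mx row_mul.
  rewrite [X in X *m R](_ : _ = 0) ?mul0mx //; apply/rowP => j.
  by rewrite !mxE gtn_eqF.
have [n [n0]] : bftors (\sum_i fam i *~ c 0 i).
  apply/bftorsP; rewrite fcoord_sum -[RHS]cG; congr (_ *m _).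
  by apply/rowP => i; rewrite mxE.
rewrite -sumrMnl; under eq_bigr do rewrite pmulrn -mulrzA.
move=> /indep c0; have: c *m L != 0.
  rewrite -row_mul mulVmx // row1; apply/eqP => /rowP/(_ (Ordinal ltm)).
  by rewrite !mxE !eqxx.
case/eqP; rewrite [c](_ : _ = 0) ?mul0mx //; apply/rowP => i; apply/eqP.
have /eqP := c0 i; rewrite mulf_eq0 eqz_nat eqn0Ngt n0 orbF.
by rewrite [X in _ -> _ == X]mxE.
Qed.

(** As [snul s] is the rank of BF, the hypothesis is delta(X) = 0; the leading coefficient is then
    the value at 1 of the cofactor in [det_pencil]. *)
Lemma gstar_smith : rord X = snul s ->
  gstar X = (-1) ^+ snul s * \prod_i sdiv s i * \det (ulsubmx (sR s *m sL s)).
Proof.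
have [h [eg <-]] := det_pencil s.
by rewrite /gstar gpolyE eg => ->; rewrite coef_Taylor1.
Qed.

End SmithCoordinates.

(** * The invariants chosen by [epsilon], computed from a Smith form *)

Lemma tors_card_uniq X n1 n2 :
  tors_card_is X n1 -> tors_card_is X n2 -> n1 = n2.
Proof.
(* Sending each representative in one list to a congruent one in the other is injective, because the
   first list is irredundant. *)
suff le m1 m2 : tors_card_is X m1 -> tors_card_is X m2 -> (m1 <= m2)%N.
  by move=> c1 c2; apply/eqP; rewrite eqn_leq !le.
move=> [s1 [size1 tors1 irr1 _]] [s2 [size2 _ _ full2]].
have F (i : 'I_m1) : exists j : 'I_m2, bfeq (nth 0 s1 i) (nth 0 s2 j).
  have [] := full2 (nth 0 s1 i); first by apply: tors1; rewrite mem_nth // size1.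
  move=> y /(nthP 0)[j]; rewrite size2 => jm <- ?.
  by exists (Ordinal jm).
have [g gP] := fin_all_exists F.
rewrite -[m1]card_ord -[m2]card_ord; apply: (leq_card g) => i j gij.
apply/val_inj/eqP; apply: contraT => /eqP ij.
case: (irr1 i j (ltn_ord i) (ltn_ord j) ij).
have [z1 e1] := gP i; have [z2 e2] := gP j; rewrite -gij in e2.
exists (z1 - z2); rewrite -[LHS](subrKA (nth 0 s2 (g i))) e1 -opprB e2.
apply: (can_inj (@zrowK X)); rewrite [LHS]raddfB /= !zrow_IminusA.
by rewrite [zrow (z1 - z2)]raddfB mulmxBl.
Qed.

Lemma card_torsE X (s : smith (lapmx X)) :
  card_tors X = absz (\prod_i sdiv s i).
Proof.
apply: tors_card_uniq (tors_card_smith s).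
by apply: epsilon_spec; exists (absz (\prod_i sdiv s i)); apply: tors_card_smith.
Qed.

Lemma bf_rankE X (s : smith (lapmx X)) : bf_rank X = snul s.
Proof.
have [ind max] := rank_smith s.
have [ind' max'] : rank_is X (bf_rank X).
  by apply: epsilon_spec; exists (snul s); apply: rank_smith.
by apply/eqP; rewrite eqn_leq max // max'.
Qed.

(** Absolute values discard the signs of (-1)^r and of the product of the divisors, to which
    divisibility is insensitive. *)
Lemma absz_mX X (s : smith (lapmx X)) : rord X = bf_rank X ->
  absz (mX X) = absz (\det (ulsubmx (sR s *m sL s))).
Proof.
rewrite (bf_rankE s) => /gstar_smith e; rewrite /mX e (card_torsE s).
set p := \prod_i _; set w := \det _.
have p0 : p != 0 by apply/prodf_neq0 => i _; apply: sdiv_neq0.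
rewrite {1}(intEsign p) -mulrA [_ * w]mulrAC mulrA mulzK ?abszMsign //.
by rewrite eqz_nat absz_eq0.
Qed.

(** * Divisibility of the leading coefficients *)

Lemma gpoly_neq0 X : gpoly X != 0.
Proof.
apply: contraTneq isT => g0; have: (gpoly X).[0] = 1; last by rewrite g0 horner0.
rewrite -[LHS]/(horner_eval 0 _) -det_map_mx -[RHS](det1 _ #|vert X|).
congr determinant; apply/matrixP => i j.
by rewrite !mxE /= /horner_eval !hornerE hornerMn hornerC.
Qed.

Lemma gstar_dvd X Y (f : dcover Y X) : (gstar X %| gstar Y)%Z.
Proof.
have [Q QP] := pushmx_split f.
pose pC m n := @map_mx int {poly int} (polyC : int -> {poly int}) m n.
have [h eg] : exists h, gpoly Y = h * gpoly X.
  rewrite !gpolyE /lapmx !subKr.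
  apply: (@det_dvd_split _ _ _ _ _ (pC _ _ (pushmx f))
    (pC _ _ (pushmx f)) (pC _ _ Q)).
    by rewrite -map_mxM QP map_mx1.
  rewrite mulmxBl mulmxBr mul1mx mulmx1 -scalemxAl -scalemxAr -!map_mxM.
  by rewrite pushmx_adjmx.
(* Orders at 1 add up and the values of the cofactors at 1 multiply, so the quotient of the leading
   coefficients is q(1). *)
have := gpoly_neq0 Y; rewrite eg mulf_eq0 negb_or => /andP[h0 gX0].
have [a [p [p1 defX]]] := factor_order1 gX0.
have [b [q [q1 defh]]] := factor_order1 h0.
have -> : gstar X = p.[1].
  by rewrite /gstar /rord defX mup1_XsubC_exp // coef_Taylor1.
rewrite /gstar /rord eg defX defh mulrACA -exprD mup1_XsubC_exp.
  by rewrite coef_Taylor1 hornerM dvdz_mull.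
by rewrite hornerM mulf_neq0.
Qed.

Lemma det_sdiv Z (s : smith (lapmx Z)) :
  \det (diag_mx (\row_i sdiv s i)) = \prod_i sdiv s i.
Proof. by rewrite det_diag; apply: eq_bigr => i _; rewrite mxE. Qed.

(** * The push-forward in Smith bases *)

Section Cover.
Variables (X Y : digraph) (f : dcover Y X).
Variables (sX : smith (lapmx X)) (sY : smith (lapmx Y)).

(** Matrices of the push-forward in the bases given by the rows of [sLi] (for [lapmx] as a map, its
    domain) and, in [push_codomain], by the rows of [sR]. *)
Definition push_domain := sLi sY *m pushmx f *m sL sX.
Definition push_codomain := sR sY *m pushmx f *m sRi sX.

Let dX := diag_mx (\row_i sdiv sX i).
Let dY := diag_mx (\row_i sdiv sY i).

Lemma push_smith :
  smithmx (snul sY) (sdiv sY) *m push_codomain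
  = push_domain *m smithmx (snul sX) (sdiv sX).
Proof.
have: sL sY *m smithmx (snul sY) (sdiv sY) *m sR sY *m pushmx f
    = pushmx f *m (sL sX *m smithmx (snul sX) (sdiv sX) *m sR sX).
  by rewrite -!smithE pushmx_lapmx.
move/(congr1 (fun A => sLi sY *m A *m sRi sX)).
rewrite !mulmxA sLiK mul1mx -[in RHS](mulmxA _ (sR sX)) sRK mulmx1.
by move=> <-.
Qed.

(** Compare blocks in [push_smith] and cancel the nonsingular diagonals. The two zero blocks say
    that the push-forward preserves saturated images and kernels. *)
Lemma push_blocks :
  [/\ dY *m ulsubmx push_codomain = ulsubmx push_domain *m dX,
      ursubmx push_codomain = 0 & dlsubmx push_domain = 0].
Proof.
have mul_diag_inj m (d : 'I_m -> int) p (A : 'M_(m, p)) :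
    (forall i, d i != 0) -> diag_mx (\row_i d i) *m A = 0 -> A = 0.
  move=> d0 /matrixP dA; apply/matrixP => i j; have := dA i j.
  by rewrite mul_diag_mx !mxE => /eqP; rewrite mulf_eq0 (negbTE (d0 i)) => /eqP.
have := push_smith; rewrite -[push_codomain]submxK -[push_domain]submxK.
rewrite !mulmx_block !(mul0mx, mulmx0, addr0).
case/eq_block_mx=> e1 e2 e3 _; rewrite !submxK; split=> //.
  exact: mul_diag_inj (sdiv_neq0 sY) e2.
apply/trmx_inj; rewrite trmx0; apply: (mul_diag_inj _ _ _ _ (sdiv_neq0 sX)).
by rewrite -tr_diag_mx -trmx_mul -e3 trmx0.
Qed.

Lemma detW_dvd :
  (\det (ulsubmx (sR sX *m sL sX)) %| \det (ulsubmx (sR sY *m sL sY)))%Z.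
Proof.
have [_ ur0 dl0] := push_blocks; have [Q QP] := pushmx_split f.
(* The rows of [B Z s] span (saturation of the image) + (kernel), written in the
   basis [sLi s]. *)
pose B Z (s : smith (lapmx Z)) : 'M_(srk s + snul s) :=
  col_mx (usubmx (sR s *m sL s)) (row_mx 0 1%:M).
have detB Z (s : smith (lapmx Z)) : \det (B Z s) = \det (ulsubmx (sR s *m sL s)).
  by rewrite /B -[usubmx _]hsubmxK -/(block_mx _ _ _ _) det_ublock det1 mulr1.
rewrite -!detB.
(* The block diagonal factor is the push-forward on the saturated image and on the kernel; the last
   argument is the section [Q] in the [sLi] bases. *)
have [||h ->] := @det_dvd_split _ _ _ (B X sX) (B Y sY)
  (block_mx (ulsubmx push_codomain) 0 0 (drsubmx push_domain)) push_domain
  (sLi sX *m Q *m sL sY).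
- rewrite /push_domain !mulmxA -(mulmxA _ (sL sY)) sLK mulmx1.
  by rewrite -(mulmxA _ Q) QP mulmx1 sLiK.
- rewrite /B mul_col_mx mul_usub_mx.
  have -> : sR sY *m sL sY *m push_domain = push_codomain *m (sR sX *m sL sX).
    rewrite /push_domain /push_codomain !mulmxA -(mulmxA _ (sL sY)) sLK mulmx1.
    by rewrite -(mulmxA _ (sRi sX)) sRiK mulmx1.
  rewrite mul_block_col !mul0mx addr0 add0r; congr col_mx.
    rewrite -[LHS]mul_usub_mx -[usubmx push_codomain]hsubmxK.
    rewrite -[X in _ *m X]vsubmxK mul_row_col.
    by rewrite [rsubmx _]ur0 mul0mx addr0.
  rewrite -{1}[push_domain]submxK dl0 mul_row_block mul_mx_row.
  by rewrite !mul0mx !mulmx0 !add0r mul1mx mulmx1.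
by rewrite dvdz_mull.
Qed.

(** In a left inverse of [push_codomain], the lower right block inverts the map of free quotients,
    which is square since the ranks agree. This forces the upper right block to vanish, leaving a
    left inverse on the saturated images. *)
Lemma push_tors_split : snul sY = snul sX ->
  exists Q : 'M_(srk sX, srk sY), Q *m ulsubmx push_codomain = 1%:M.
Proof.
move=> r_eq; have [_ ur0 _] := push_blocks; have [Q QP] := pushmx_split f.
pose Q' := sR sX *m Q *m sRi sY; exists (ulsubmx Q').
have: Q' *m push_codomain = 1%:M.
  rewrite /Q' /push_codomain !mulmxA -(mulmxA _ (sRi sY)) sRiK mulmx1.
  by rewrite -(mulmxA _ Q) QP mulmx1 sRK.
rewrite -[Q']submxK -[push_codomain]submxK ur0 mulmx_block !mulmx0 !add0r.
rewrite scalar_mx_block => /eq_block_mx[e1 e2 _ e4].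
have ur'0 : ursubmx Q' = 0.
  rewrite -[LHS]mulmx1 -(mulmx1C_eqdim (esym r_eq) e4) mulmxA e2 mul0mx //.
by rewrite submxK block_mxKul -e1 ur'0 mul0mx addr0.
Qed.

(** Torsion vectors are those of the saturated image, where the push-forward splits; hence they lift
    exactly, not merely modulo the image. *)
Lemma tors_push_surj : snul sY = snul sX ->
  forall x, bftors x -> exists2 y, bftors y & push f y = x.
Proof.
move=> /push_tors_split[Q QP] x /(bftorsP sX) fx0.
have [_ ur0 _] := push_blocks.
exists (zvec sY (tcoord sX x *m Q) 0).
  by apply/(bftorsP sY); rewrite fcoord_zvec.
apply: (can_inj (@zrowK X)); rewrite zrow_push zrow_zvec.
rewrite -[in RHS](zvec_coord sX x) zrow_zvec fx0.
rewrite -[LHS]mulmx1 -(sRiK sX) !mulmxA; congr (_ *m _).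
transitivity (row_mx (tcoord sX x *m Q) 0 *m push_codomain).
  by rewrite /push_codomain !mulmxA.
rewrite -[push_codomain]submxK mul_row_block ur0 !mul0mx mulmx0 !addr0.
by rewrite -mulmxA QP mulmx1.
Qed.

Lemma tors_order_dvd : snul sY = snul sX ->
  (\prod_i sdiv sX i %| \prod_i sdiv sY i)%Z.
Proof.
move=> /push_tors_split[Q QP]; have [e _ _] := push_blocks.
by have [h] := det_dvd_split QP e; rewrite !det_sdiv => ->; rewrite dvdz_mull.
Qed.

End Cover.

Theorem theorem2p14 (X Y : digraph) (f : dcover Y X)
  (hX : strongly_connected X) (hY : strongly_connected Y) :
  [/\ (gstar X %| gstar Y)%Z,
      rord X = bf_rank X -> rord Y = bf_rank Y -> (mX X %| mX Y)%Z &
      rord X = bf_rank X -> rord Y = bf_rank Y -> rord X = rord Y ->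
        (forall x : ZV X, bftors x ->
           exists2 y : ZV Y, bftors y & bfeq (push f y) x)
        /\ (card_tors X %| card_tors Y)%N].
Proof.
have sX := smith_form (lapmx X); have sY := smith_form (lapmx Y).
split; first exact: gstar_dvd f.
  move=> rX rY; rewrite dvdzE (absz_mX sX rX) (absz_mX sY rY) -dvdzE.
  exact: detW_dvd.
rewrite (bf_rankE sX) (bf_rankE sY) => -> -> /esym r_eq; split.
  move=> x /(tors_push_surj f r_eq)[y tors_y fy]; exists y => //.
  by rewrite fy; apply/(bfeqP sX); split=> // i; rewrite subrr dvdz0.
by rewrite !(card_torsE sX, card_torsE sY) -dvdzE; apply: tors_order_dvd f _ _ r_eq.
Qed.
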